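(* Let $(K,\mathcal F)$ be a presentable measurable space and let $X=(X_n)_{n\in\mathbb Z}$ be a stationary process with values in $K$. Then the following properties are equivalent: (1) $X$ is exchangeable. (2) $X$ is quasi-exchangeable with uniformly integrable densities. (3) $X$ is a mixture of Bernoulli processes.
   Context: Let $\Omega=K^{\mathbb Z}$ with the product $\sigma$-algebra $\mathcal B=\mathcal F^{\otimes\mathbb Z}$, and let $\mu$ be the law of $X$ on $\Omega$. Stationary means that $\mu$ is invariant under the shift $(S\omega)_n=\omega_{n+1}$. $H$ is the group of permutations $\sigma$ of $\mathbb Z$ with finite support. For $\sigma\in H$, $T_\sigma:\Omega\to\Omega$ is $(T_\sigma\omega)_n=\omega_{\sigma(n)}$. The process is exchangeable if $\mu\circ T_\sigma^{-1}=\mu$ for all $\sigma\in H$. It is quasi-exchangeable if $\mu\circ T_\sigma^{-1}$ is equivalent to $\mu$ (same null sets) for all $\sigma\in H$. It is quasi-exchangeable with uniformly integrable densities if it is quasi-exchangeable and the family of Radon–Nikodym derivatives $\left\{\frac{d\mu\circ T_\sigma^{-1}}{d\mu}:\sigma\in H\right\}$ is uniformly integrable in $L^1(\mu)$. $X$ is a mixture of Bernoulli processes if there is a probability measure $\beta$ on the set of probability measures $\pi$ on $(K,\mathcal F)$ (with the $\sigma$-algebra generated by the evaluations $\pi\mapsto\pi(A)$, $A\in\mathcal F$) such that $\mu(A)=\int \pi^{\otimes\mathbb Z}(A)\,d\beta(\pi)$ for all $A\in\mathcal B$. The measurable space $(K,\mathcal F)$ is presentable (in the sense of Hewitt and Savage)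 if every exchangeable probability measure on the infinite product $K^{\mathbb N}$, i.e. every one invariant under all finite permutations of the coordinates, is a mixture, in the same sense, of product measures $\pi^{\otimes\mathbb N}$. For example, Polish spaces with their Borel $\sigma$-algebra and compact Hausdorff spaces with their Baire $\sigma$-algebra are presentable. *)

(* Defs.v *)
From HB Require Import structures.
From mathcomp Require Import all_boot all_order all_algebra.
From mathcomp Require Import all_classical all_reals all_analysis.
From mathcomp Require Import measurable_realfun.

Set Implicit Arguments.
Unset Strict Implicit.
Unset Printing Implicit Defensive.
Import Order.TTheory GRing.Theory Num.Theory.
Import numFieldNormedType.Exports.
Local Open Scope classical_set_scope.
Local Open Scope ring_scope.
Local Open Scope ereal_scope.
Local Open Scope charge_scope.

(* Written for MathComp-Analysis.  A [measurableType] is nonempty; this loses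
   nothing, since a space carrying a K-valued process is nonempty.  Two terms
   of type [probability T R] may differ on nonmeasurable sets, so equality of
   measures is always expressed on measurable sets only. *)

Section sequence_space.
Context (I : Type) d (K : measurableType d).

Definition coordinate_sets : set (set (I -> K)) :=
  \bigcup_(i in [set: I])
    preimage_set_system [set: I -> K] (fun w => w i) measurable.

(* K^I with the product sigma-algebra, i.e. the one generated by the
   coordinate maps. *)
Definition seqspace : measurableType coordinate_sets.-sigma :=
  g_sigma_algebraType coordinate_sets.

Lemma measurable_coordinate (i : I) (A : set K) : measurable A ->
  measurable ([set w | A (w i)] : set seqspace).
Proof.
by move=> mA; apply: sub_sigma_algebra; exists i => //; exists A; rewrite ?setTI.
Qed.

Lemma measurable_to_seqspace d' (T : measurableType d') (f : T -> seqspace) :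
  (forall i, measurable_fun [set: T] (fun t => f t i)) ->
  measurable_fun [set: T] f.
Proof.
move=> mf; apply: (measurability (coordinate_sets : set (set seqspace))) => //.
move=> _ [_ [i _ [A mA <-]] <-].
by rewrite [X in _ `&` _ @^-1` X]setTI; apply: mf.
Qed.

End sequence_space.

Section reindexing.
Context (I J : Type) d (K : measurableType d) (s : J -> I).

Definition reindex (w : seqspace I K) : seqspace J K := fun j => w (s j).

Lemma measurable_reindex : measurable_fun [set: seqspace I K] reindex.
Proof.
apply: measurable_to_seqspace => j _ A mA.
by rewrite setTI; exact: (measurable_coordinate (s j)).
Qed.

HB.instance Definition _ :=
  isMeasurableFun.Build _ _ _ _ reindex measurable_reindex.
End reindexing.

Section path.
Context (I : Type) d d' (Om : measurableType d') (K : measurableType d)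
  (R : realType) (P : probability Om R) (X : I -> {RV P >-> K}).

Definition path_of (t : Om) : seqspace I K := fun i => X i t.

Lemma measurable_path_of : measurable_fun [set: Om] path_of.
Proof. by apply: measurable_to_seqspace => i; exact: measurable_funPT. Qed.

HB.instance Definition _ :=
  isMeasurableFun.Build _ _ _ _ path_of measurable_path_of.

Definition law : probability (seqspace I K) R := distribution P path_of.
End path.

(* Construction of the product measure p^{(x)I} for a countable index set I:
   the product set function on finite-dimensional measurable boxes of K^nat is
   sigma-additive, its extension is transported to K^I along an injection of I
   into nat.  The outcome is [product_power] below, characterized by
   [product_powerE]; the intermediate definitions play no other role. *)

Section box.
Context d (K : measurableType d) (R : realType) (p : probability K R).
Implicit Types (A B : nat -> set K) (w : nat -> K).

Definition box A : set (nat -> K) := [set w | forall i, A i (w i)].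

Definition box_sides A n :=
  (forall i, measurable (A i)) /\ (forall i, (n <= i)%N -> A i = setT).

(* The conditional measure of [box A] given the first j coordinates of w. *)
Definition weight A n j w : R :=
  (\prod_(i < n) if (i < j)%N then \1_(A i) (w i) else fine (p (A i)))%R.

Definition upd w j x : nat -> K := fun i => if i == j then x else w i.

Lemma weight_ge0 A n j w : (0 <= weight A n j w)%R.
Proof.
by apply: prodr_ge0 => i _; case: ifP => _; [rewrite indicE|rewrite fine_ge0].
Qed.

Lemma eq_weight A n j w w' : (forall i, (i < j)%N -> w i = w' i) ->
  weight A n j w = weight A n j w'.
Proof. by move=> ww'; apply: eq_bigr => i _; case: ifPn => // /ww' ->. Qed.

Lemma weight_step A n j w : (forall i, measurable (A i)) ->
  exists2 c : R, (0 <= c)%R & exists2 B, measurable B &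
   ((forall x, weight A n j.+1 (upd w j x) = c * \1_B x)%R /\
   (weight A n j w)%:E = c%:E * p B).
Proof.
move=> mA; have [jn|nj] := ltnP j n; last first.
  exists (weight A n j w); first exact: weight_ge0.
  exists setT => //; split=> [x|]; last by rewrite probability_setT mule1.
  rewrite indicT /= mulr1; apply: eq_bigr => i _.
  have ij : (i < j)%N by exact: leq_trans (ltn_ord i) nj.
  by rewrite ij ltnS (ltnW ij) /upd (ltn_eqF ij).
pose c := (\prod_(i < n | i != Ordinal jn)
  if (i < j)%N then \1_(A i) (w i) else fine (p (A i)))%R.
exists c.
  by apply: prodr_ge0 => i _; case: ifP => _; [rewrite indicE|rewrite fine_ge0].
exists (A j) => //; split => [x|].
  rewrite /weight (bigD1 (Ordinal jn)) //= ltnSn /upd eqxx mulrC; congr (_ * _)%R.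
  apply: eq_bigr => i ij.
  have /negbTE ij' : i != j :> nat by [].
  by rewrite ltnS leq_eqVlt ij' /=.
rewrite /weight (bigD1 (Ordinal jn)) //= ltnn mulrC EFinM fineK //.
exact: fin_num_measure.
Qed.

Lemma measurable_weight A n j w : (forall i, measurable (A i)) ->
  measurable_fun [set: K] (fun x => (weight A n j.+1 (upd w j x))%:E : \bar R).
Proof.
move=> mA; have [c c0 [B mB [cB _]]] := weight_step n j w mA.
apply/measurable_EFinP; under eq_fun do rewrite cB.
by apply: measurable_funM => //; exact: measurable_indic.
Qed.

Lemma integral_weight A n j w : (forall i, measurable (A i)) ->
  \int[p]_x (weight A n j.+1 (upd w j x))%:E = (weight A n j w)%:E.
Proof.
move=> mA; have [c c0 [B mB [cB ->]]] := weight_step n j w mA.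
under eq_integral do rewrite cB EFinM.
rewrite ge0_integralZl//.
- by rewrite integral_indic// setIT.
- by apply/measurable_EFinP; exact: measurable_indic.
Qed.

Lemma weight0 A n w : (forall i, measurable (A i)) ->
  (weight A n 0 w)%:E = \prod_(i < n) p (A i).
Proof.
move=> mA; apply: (big_ind2 (fun (x : R) y => x%:E = y)) => //.
  by move=> x _ y _ <- <-; rewrite EFinM.
by move=> i _; rewrite fineK//; exact: fin_num_measure.
Qed.

Lemma weight_neq0 A n j w : box_sides A n -> weight A n j w != 0%R ->
  exists2 w', box A w' & forall i, (i < j)%N -> w' i = w i.
Proof.
move=> [mA AT] /prodf_neq0 W0.
have Ai i : exists x, A i x /\ ((i < j)%N -> x = w i).
  have [ni|ni] := leqP n i.
    by exists (w i); rewrite AT.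
  have := W0 (Ordinal ni) isT => /=; case: ifPn => [ij|ij pA].
    rewrite indicE pnatr_eq0 eqb0 negbK => /set_mem Awi.
    by exists (w i).
  have : A i !=set0.
    apply/set0P; apply: contra pA => /eqP ->.
    by rewrite measure0.
  by move=> [x Ax]; exists x.
have [w' w'P] := choice Ai.
by exists w' => i; have [] := w'P i.
Qed.

Lemma weight_in A n j w : (n <= j)%N -> box A w ->
  weight A n j w = 1%R.
Proof.
move=> nj Aw; apply: big1 => i _.
by rewrite (leq_trans (ltn_ord i) nj) indicE mem_set//; exact: Aw.
Qed.

Lemma box_sigma_additive A n (B : nat -> nat -> set K) (m : nat -> nat) :
  box_sides A n -> (forall k, box_sides (B k) (m k)) ->
  trivIset setT (fun k => box (B k)) -> box A = \bigcup_k box (B k) ->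
  \prod_(i < n) p (A i) = \sum_(k <oo) \prod_(i < m k) p (B k i).
Proof.
move=> hA hB tB AB.
pose f j w := (weight A n j w)%:E.
pose g j w := \sum_(k <oo) (weight (B k) (m k) j w)%:E.
have step j w : f j w != g j w -> exists x, f j.+1 (upd w j x) != g j.+1 (upd w j x).
  apply: contra_neqP => /forallNP fg.
  rewrite /f /g -integral_weight//; last exact: hA.1.
  transitivity (\int[p]_x (g j.+1 (upd w j x))).
    by apply: eq_integral => x _; apply/eqP/negPn/negP/fg.
  rewrite /g integral_nneseries//.
  - by apply: eq_eseriesr => k _; rewrite integral_weight//; exact: (hB k).1.
  - by move=> k; apply: measurable_weight; exact: (hB k).1.
  - by move=> k x _; rewrite lee_fin weight_ge0.
apply/eqP; apply: contraT => neq.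
have neq0 : f 0%N point != g 0%N point.
  rewrite /f /g weight0; last exact: hA.1.
  by under eq_eseriesr do [rewrite weight0; last exact: (hB _).1].
pose next j w := upd w j (xget point [set x | f j.+1 (upd w j x) != g j.+1 (upd w j x)]).
pose W := fix W j := if j is j'.+1 then next j' (W j') else (point : nat -> K).
have WP j : f j (W j) != g j (W j).
  elim: j => [//|j IH].
  have [x Px] := step _ _ IH.
  by rewrite /= /next; case: xgetP => [y _ //|/(_ x)].
pose w i := W i.+1 i.
have Ww j i : (i < j)%N -> W j i = w i.
  elim: j => // j IH; rewrite ltnS leq_eqVlt => /predU1P[->//|ij].
  by rewrite /= /next /upd (ltn_eqF ij) IH.
have wP j : f j w != g j w.
  have -> : f j w = f j (W j).
    by congr EFin; apply: eq_weight => i /Ww.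
  have -> // : g j w = g j (W j).
  by apply: eq_eseriesr => k _; congr EFin; apply: eq_weight => i /Ww.
have [Aw|nAw] := pselect (box A w).
- have [k _ Bkw] : (\bigcup_k box (B k)) w by rewrite -AB.
  pose j := maxn n (m k).
  have := wP j; rewrite /f weight_in ?leq_maxl// => /eqP; elim.
  rewrite /g (@nneseriesD1 _ _ k)//; last by move=> l _; rewrite lee_fin weight_ge0.
  rewrite weight_in ?leq_maxr// eseries0 ?adde0// => l _ lk.
  apply: congr1; apply/eqP; apply: contraT => /(weight_neq0 (hB l))[w' Blw' w'w].
  suff Bkw' : box (B k) w'.
    move/trivIsetP : tB => /(_ l k Logic.I Logic.I lk) /seteqP[/(_ w')].
    by case.
  move=> i; have [ij|ij] := ltnP i j; first by rewrite w'w//; exact: Bkw.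
  by rewrite (hB k).2//; apply: leq_trans ij; exact: leq_maxr.
- have := wP n => /eqP; elim.
  have nAw' w' : (forall i, (i < n)%N -> w' i = w i) -> ~ box A w'.
    move=> w'w Aw'; apply: nAw => i; have [ni|ni] := ltnP i n.
      by rewrite -w'w//; exact: Aw'.
    by rewrite hA.2.
  transitivity (0 : \bar R).
    rewrite /f; apply: congr1; apply/eqP; apply: contraT => /(weight_neq0 hA)[w' Aw' w'w].
    by have := nAw' _ w'w.
  rewrite /g eseries0// => l _ _.
  apply: congr1; apply/eqP; apply: contraT => /(weight_neq0 (hB l))[w' Blw' w'w].
  by exfalso; apply: (nAw' _ w'w); rewrite AB; exists l.
Qed.
End box.

Definition boxspace (K : Type) : Type := nat -> K.

Section box_semiring.
Context d (K : measurableType d).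

Definition boxes : set (set (boxspace K)) :=
  [set S | exists A n, @box_sides _ K A n /\ S = box A].

Let boxes0 : boxes set0.
Proof.
exists (fun i => if i is 0%N then set0 else setT), 1%N; split.
  by split=> [[|i]|[|i]] //.
by apply/esym/seteqP; split => w // /(_ 0%N).
Qed.

Let boxesI : setI_closed boxes.
Proof.
move=> _ _ [A [n [[mA hA] ->]]] [B [m [[mB hB] ->]]].
exists (fun i => A i `&` B i), (maxn n m); split.
  split=> i; first exact: measurableI.
  by rewrite geq_max => /andP[ni mi]; rewrite hA// hB// setIT.
apply/seteqP; split => w /=; first by move=> [Aw Bw] i; split; [exact: Aw|exact: Bw].
by move=> ABw; split=> i; have [] := ABw i.
Qed.

Let boxesD : semi_setD_closed boxes.
Proof.
move=> _ _ [A [n [[mA hA] ->]]] [B [m [[mB hB] ->]]].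
pose C (j i : nat) := if (i < j)%N then A i `&` B i else
  if i == j then A i `\` B i else A i.
exists [set box (C j) | j in `I_m]; split.
- exact/finite_image/finite_II.
- move=> _ [j /= jm <-]; exists (C j), (maxn n m); split=> //; split=> i.
    rewrite /C; case: ifP => _; first exact: measurableI.
    by case: ifP => // _; exact: measurableD.
  rewrite geq_max /C => /andP[ni mi].
  by rewrite ltnNge ltnW ?(leq_trans jm)//= gtn_eqF ?(leq_trans jm)// hA.
- apply/seteqP; split => w /=.
    move=> [Aw /existsNP nBw].
    have exB : exists i, ~~ `[< B i (w i) >].
      by have [i Bi] := nBw; exists i; apply/asboolPn.
    have [j /asboolPn nBj jmin] := ex_minnP exB.
    exists (box (C j)).
      exists j => //=; rewrite ltnNge; apply/negP => mj.
      by apply: nBj; rewrite hB.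
    move=> i; rewrite /C; case: ltngtP => ij; last by subst i; split; [exact: Aw|].
      split; first exact: Aw.
      by apply/asboolP; apply: contraTT ij => /jmin; rewrite -leqNgt.
    exact: Aw.
  move=> [_ [j jm <-]] Cw; split=> [i|Bw].
    have := Cw i; rewrite /C; case: ltngtP => _ //; first by case.
    by case.
  by have := Cw j; rewrite /C ltnn eqxx => -[_]; apply; exact: Bw.
- move=> _ _ [j _ <-] [k _ <-] [w [wj wk]].
  have disj a b : (a < b)%N -> box (C a) w -> ~ box (C b) w.
    move=> ab Ca Cb; have := Ca a; have := Cb a.
    by rewrite /C ab ltnn eqxx => -[_ Bw] -[_].
  by have [jk|kj|->//] := ltngtP j k; [case: (disj _ _ jk wj wk)|
    case: (disj _ _ kj wk wj)].
Qed.

HB.instance Definition _ := Pointed.on (boxspace K).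
HB.instance Definition _ := @isSemiRingOfSets.Build default_measure_display
  (boxspace K) boxes boxes0 boxesI boxesD.

Context (R : realType) (p : probability K R).

Definition box_measure (S : set (boxspace K)) : \bar R :=
  xget 0 [set x | exists A n, [/\ @box_sides _ K A n, S = box A &
                                  x = \prod_(i < n) p (A i)]].

Lemma box_measureE A n : box_sides A n ->
  box_measure (box A) = \prod_(i < n) p (A i).
Proof.
move=> hA; rewrite /box_measure; case: xgetP => [x _|/(_ (\prod_(i < n) p (A i)))]; last first.
  by case; exists A, n.
move=> [B [m [hB AB ->]]].
pose C k := if k is 0%N then A else fun i => if i is 0%N then set0 else setT.
pose l k := if k is 0%N then n else 1%N.
have hC k : box_sides (C k) (l k) by case: k => [|k]; [exact: hA|split=> [[|i]|[|i]] //=].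
have C0 k : box (C k.+1) = set0.
  by apply/seteqP; split => w // /(_ 0%N).
rewrite (box_sigma_additive p hB hC).
- rewrite (@nneseriesD1 _ _ 0%N)//; last first.
    by move=> k _; rewrite -(@weight0 _ _ _ p _ _ point (hC k).1) lee_fin weight_ge0.
  by rewrite eseries0 ?adde0// => -[|k] //= _ _; rewrite big_ord1 measure0.
- apply/trivIsetP => -[|i] [|j] // _ _ _; rewrite C0 ?set0I ?setI0//.
- apply/seteqP; split => w.
    by rewrite -AB => Aw; exists 0%N.
  by move=> [[|k] _]; rewrite ?C0// -AB.
Qed.

Let box_measure0 : box_measure set0 = 0.
Proof.
pose C (i : nat) : set K := if i is 0%N then set0 else setT.
have hC : box_sides C 1 by split=> [[|i]|[|i]] //=.
have -> : set0 = box C by apply/esym/seteqP; split => w // /(_ 0%N).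
by rewrite (box_measureE hC) big_ord1 measure0.
Qed.

Let box_measure_ge0 S : 0 <= box_measure S.
Proof.
rewrite /box_measure; case: xgetP => [x _ [A [n [hA _ ->]]]|//].
by rewrite -(@weight0 _ _ _ p _ _ point hA.1) lee_fin weight_ge0.
Qed.

Let box_measure_sigma_additive : semi_sigma_additive box_measure.
Proof.
move=> F /choice[B /choice[m hF]] tF [A [n [hA AF]]].
have FB k : F k = box (B k) by have [] := hF k.
have hB k : box_sides (B k) (m k) by have [] := hF k.
have -> : box_measure (\bigcup_k F k) = \sum_(k <oo) box_measure (F k).
  rewrite AF (box_measureE hA) (box_sigma_additive p hA hB).
  - by apply: eq_eseriesr => k _; rewrite FB (box_measureE (hB k)).
  - by under eq_fun do rewrite -FB.
  - by rewrite -AF; apply: eq_bigcupr.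
by apply: is_cvg_nneseries.
Qed.

HB.instance Definition _ := isMeasure.Build _ _ _ box_measure
  box_measure0 box_measure_ge0 box_measure_sigma_additive.

End box_semiring.

Section product_power.
Context (I : countType) d (K : measurableType d) (R : realType).
Variable p : probability K R.

Definition box_sigma_space := g_sigma_algebraType (@measurable _ (boxspace K)).
Definition box_extension : set box_sigma_space -> \bar R :=
  measure_extension (box_measure p).

Let box_extensionE A n : box_sides A n -> box_extension (box A) = \prod_(i < n) p (A i).
Proof.
move=> hA; rewrite /box_extension /measure_extension measurable_mu_extE; last by exists A, n.
exact: box_measureE.
Qed.

Let box_extensionT : box_extension [set: box_sigma_space] = 1.
Proof.
have hT : box_sides (fun=> [set: K]) 0 by split.
have -> : [set: box_sigma_space] = box (fun=> [set: K]) by apply/seteqP; split.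
by rewrite (box_extensionE hT) big_ord0.
Qed.

HB.instance Definition _ :=
  Measure.copy box_extension (measure_extension (box_measure p)).
HB.instance Definition _ := Measure_isProbability.Build _ _ _ box_extension box_extensionT.

Definition of_box_sigma_space (w : box_sigma_space) : seqspace I K := fun i => w (pickle i).

Let measurable_of_box_sigma_space : measurable_fun [set: box_sigma_space] of_box_sigma_space.
Proof.
apply: measurable_to_seqspace => i _ A mA; rewrite setTI.
apply: sub_sigma_algebra.
exists (fun n => if n == pickle i then A else setT), (pickle i).+1; split.
  split=> n; first by case: ifP.
  by move=> /gtn_eqF ->.
apply/seteqP; split => w /=; last by move=> /(_ (pickle i)); rewrite eqxx.
by move=> Aw n; case: eqP => // ->.
Qed.

HB.instance Definition _ :=
  isMeasurableFun.Build _ _ _ _ of_box_sigma_space measurable_of_box_sigma_space.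

Lemma product_power_exists : exists Q : probability (seqspace I K) R,
  forall (s : seq I) (A : I -> set K), uniq s ->
    (forall i, measurable (A i)) ->
  Q [set w | forall i, i \in s -> A i (w i)] = \prod_(i <- s) p (A i).
Proof.
exists (distribution box_extension of_box_sigma_space) => s A us mA.
pose B n := \big[setI/setT]_(i <- s | pickle i == n) A i.
pose N := (\max_(i <- s) pickle i).+1.
have Npickle i : i \in s -> (pickle i < N)%N.
  by move=> si; rewrite ltnS; exact: leq_bigmax_seq.
have hB : box_sides B N.
  split=> n; first by apply: bigsetI_measurable.
  move=> Nn; rewrite /B big_seq_cond big_pred0// => i.
  apply/andP => -[/Npickle iN /eqP ni]; by move: iN; rewrite ni ltnNge Nn.
have Bpickle i : i \in s -> B (pickle i) = A i.
  move=> si; rewrite /B -big_filter.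
  rewrite (_ : [seq _ <- s | _] = [:: i]) ?big_seq1//.
  rewrite (eq_filter (a2 := pred1 i)) ?filter_pred1_uniq// => j /=.
  by rewrite (inj_eq (pcan_inj pickleK)).
have EB : of_box_sigma_space @^-1` [set w | forall i, i \in s -> A i (w i)] = box B.
  apply/seteqP; split => w /= Aw.
    move=> n; rewrite /B -bigcap_seq_cond => i /= /andP[si /eqP <-].
    exact: Aw.
  by move=> i si; rewrite -Bpickle//; exact: Aw.
transitivity (box_extension (box B)); first by rewrite -EB.
rewrite (box_extensionE hB) -(big_mkord xpredT (fun n => p (B n))).
rewrite (bigID (mem (map pickle s)))/= [X in _ * X]big1_seq ?mule1; last first.
  move=> n /andP[ns _]; rewrite /B -big_filter (_ : [seq _ <- s | _] = [::]).
    by rewrite big_nil probability_setT.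
  apply/eqP; rewrite -[_ == _]negbK -has_filter; apply: contra ns.
  by move=> /hasP[i si /eqP <-]; exact: map_f.
rewrite -big_filter.
rewrite (perm_big (map pickle s)); last first.
  apply: uniq_perm; [by rewrite filter_uniq// iota_uniq| |].
    by rewrite map_inj_uniq//; exact: pcan_inj pickleK.
  move=> n; rewrite mem_filter mem_index_iota/= andbC.
  apply/andb_idl => /mapP[i si ->]; exact: Npickle.
by rewrite big_map; apply: eq_big_seq => i /Bpickle ->.
Qed.

(* The statement above determines the measure on measurable sets, as the
   finite-dimensional boxes generate the product sigma-algebra and are stable
   under intersection. *)
Definition product_power : probability (seqspace I K) R :=
  sval (cid product_power_exists).

Lemma product_powerE (s : seq I) (A : I -> set K) : uniq s ->
    (forall i, measurable (A i)) ->
  product_power [set w | forall i, i \in s -> A i (w i)] =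
    \prod_(i <- s) p (A i).
Proof. by move=> us mA; rewrite (svalP (cid product_power_exists)). Qed.

End product_power.
Arguments product_power I {d K R} p.

Section uniform_integrability.
Context d (T : measurableType d) (R : realType).

Definition uniformly_integrable (mu : {measure set T -> \bar R})
    (F : set (T -> \bar R)) :=
  (forall f, F f -> mu.-integrable [set: T] f) /\
  (forall e : R, (0 < e)%R -> exists c : R, forall f, F f ->
    \int[mu]_(x in [set x | c%:E < `|f x|]) `|f x| <= e%:E).

End uniform_integrability.

Section exchangeability.
Context (I : Type) d (K : measurableType d) (R : realType).
Implicit Type mu : probability (seqspace I K) R.

Definition finite_permutation (s : I -> I) :=
  bijective s /\ finite_set [set n | s n <> n].

Definition exchangeable mu := forall s, finite_permutation s ->
  forall A, measurable A -> distribution mu (reindex s) A = mu A.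

Definition quasi_exchangeable mu := forall s, finite_permutation s ->
  distribution mu (reindex s) `<< mu /\ mu `<< distribution mu (reindex s).

Definition permutation_densities mu : set (seqspace I K -> \bar R) :=
  [set 'd (charge_of_finite_measure (distribution mu (reindex s))) '/d mu
    | s in finite_permutation].

Definition quasi_exchangeable_ui mu :=
  quasi_exchangeable mu /\ uniformly_integrable mu (permutation_densities mu).

End exchangeability.

Section mixtures.
Context (I : countType) d (K : measurableType d) (R : realType).

Definition mixture_of_product_powers (mu : probability (seqspace I K) R) :=
  exists beta : probability (pprobability K R) R,
    forall A : set (seqspace I K), measurable A ->
      mu A = \int[beta]_p product_power I p A.

End mixtures.

Definition presentable d (K : measurableType d) (R : realType) :=
  forall mu : probability (seqspace nat K) R,
    exchangeable mu -> mixture_of_product_powers mu.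

Definition stationary d (K : measurableType d) (R : realType)
    (mu : probability (seqspace int K) R) :=
  forall A, measurable A ->
    distribution mu (reindex (fun n : int => (n + 1)%R)) A = mu A.

(* Main.v *)
(* (2) => (1) is the heart of the matter.  Let the event [C] depend only on the
   coordinates in [-N, N], let [s] be a finite permutation supported there, and
   cut the integers into blocks of length [2N + 1].  By stationarity, the average
   of the translates of [\1_C] over blocks [0, n) and the one over blocks [n, 2n)
   have an L^2 distance that is small for suitable [n].  Copying [s] on the
   blocks [0, n) gives a finite permutation, which leaves the second average
   alone and turns the first one into an average of translates of
   [\1_(reindex s @^-1` C)].  Uniform integrability of the densities keeps the
   difference small in measure after this permutation, uniformly in [n]; taking
   expectations, [mu (reindex s @^-1` C) = mu C].

   (1) => (3) transports the law to K^nat along a bijection of the index sets,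
   (3) => (1) holds as product powers are exchangeable, and under (1) the
   densities are almost surely 1. *)
Require Import Defs.
From HB Require Import structures.
From mathcomp Require Import all_boot all_order all_algebra.
From mathcomp Require Import all_classical all_reals all_analysis.
From mathcomp Require Import measurable_realfun.
From mathcomp Require Import ring lra zify.

(* [reindex] is to be that of Defs rather than that of bigop. *)
Import Defs.

Set Implicit Arguments.
Unset Strict Implicit.
Unset Printing Implicit Defensive.
Import Order.TTheory GRing.Theory Num.Theory.
Import numFieldNormedType.Exports.
Local Open Scope classical_set_scope.
Local Open Scope ring_scope.
Local Open Scope charge_scope.

(** * Finite-dimensional cylinders and uniqueness of measures on [K^I] *)

Lemma measurable_cylinder (I : eqType) d (K : measurableType d) (s : seq I)
    (A : I -> set K) : (forall i, measurable (A i)) ->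
  measurable ([set w | forall i, i \in s -> A i (w i)] : set (seqspace I K)).
Proof.
move=> mA; elim: s => [|j s IHs].
  by rewrite (_ : [set _ | _] = setT)//; apply/seteqP; split.
rewrite (_ : [set _ | _] = [set w : seqspace I K | A j (w j)] `&`
    [set w | forall i, i \in s -> A i (w i)]).
  by apply: measurableI => //; exact: measurable_coordinate.
apply/seteqP; split => [w Aw|w [Ajw Asw] i].
  by split=> [|i si]; apply: Aw; rewrite inE ?eqxx// si orbT.
by rewrite inE => /predU1P[->//|]; exact: Asw.
Qed.

(** Pi-lambda argument: the cylinders are stable under intersection and generate the product
    sigma-algebra. *)
Lemma seqspace_probability_unique (I : eqType) d (K : measurableType d)
    (R : realType) (m1 m2 : probability (seqspace I K) R) :
  (forall (s : seq I) (A : I -> set K), uniq s ->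
    (forall i, measurable (A i)) ->
    m1 [set w | forall i, i \in s -> A i (w i)] =
    m2 [set w | forall i, i \in s -> A i (w i)]) ->
  forall B, measurable B -> m1 B = m2 B.
Proof.
move=> m12.
pose G : set (set (seqspace I K)) := [set B | exists s, exists A : I -> set K,
  [/\ uniq s, forall i, measurable (A i) &
      B = [set w | forall i, i \in s -> A i (w i)]]].
have GT : G setT.
  by exists [::], (fun=> setT); split => //; apply/seteqP; split.
apply: (@measure_unique _ R _ G (fun=> setT)) => //.
- rewrite eqEsubset; split; last first.
    apply: smallest_sub; first exact: sigma_algebra_measurable.
    by move=> _ [s [A [_ mA ->]]]; exact: measurable_cylinder.
  apply: smallest_sub; first exact: smallest_sigma_algebra.
  move=> _ [i _ [A mA <-]]; apply: sub_gen_smallest.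
  exists [:: i], (fun=> A); split => //; rewrite setTI.
  by apply/seteqP; split=> [w Aw j|w]; [rewrite inE => /eqP ->|apply; rewrite inE].
- move=> _ _ [s [A [us mA ->]]] [t [B [ut mB ->]]].
  (* Outside its own index list each cylinder leaves the coordinate free, so its side must be reset
     to [setT] there before intersecting. *)
  exists (undup (s ++ t)), (fun i => (if i \in s then A i else setT) `&`
                              (if i \in t then B i else setT)).
  split=> [|i|]; first exact: undup_uniq.
    by apply: measurableI; case: ifP.
  apply/seteqP; split=> w /=.
    by move=> [Aw Bw] i _; split; case: ifPn => // ?; [exact: Aw|exact: Bw].
  move=> ABw; split=> i si; have := ABw i;
    rewrite mem_undup mem_cat si ?orbT => /(_ erefl)[]//.
- by apply/seteqP; split=> // w _; exists 0%N.
- by move=> _ [s [A [us mA ->]]]; exact: m12.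
- by move=> _; apply: le_lt_trans (probability_le1 m1 measurableT) (ltry 1).
Qed.

Lemma measurable_preimage_reindex (I J : Type) d (K : measurableType d)
    (s : J -> I) (B : set (seqspace J K)) : measurable B ->
  measurable (reindex s @^-1` B : set (seqspace I K)).
Proof.
by move=> mB; rewrite -[X in measurable X]setTI; exact: measurable_reindex.
Qed.

(** * Mixtures of product powers under reindexing, and densities of permuted laws *)

Section mixtures_and_densities.
Local Open Scope ereal_scope.

(** Distinct indices read distinct coordinates, so both measures give a cylinder the same product of
    masses. This serves for permutations of [I] and for a change of index set alike. *)
Lemma product_power_reindex (I J : countType) d (K : measurableType d)
    (R : realType) (p : probability K R) (s : J -> I) (B : set (seqspace J K)) :
  injective s -> measurable B ->
  product_power I p (reindex s @^-1` B) = product_power J p B.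
Proof.
move=> sI; apply: (seqspace_probability_unique
  (m1 := distribution (product_power I p) (reindex s))) => r A ur mA.
rewrite product_powerE//.
(* Sides pushed forward along [s]: by injectivity at most one [j] contributes, and the empty
   intersection is [setT]. *)
pose A' i := \bigcap_(j in [set j | s j = i /\ j \in r]) A j.
have A'E j : j \in r -> A' (s j) = A j.
  move=> jr; apply/seteqP; split=> x; first by apply.
  by move=> Ax k [/sI ->].
transitivity (product_power I p [set w | forall i, i \in map s r -> A' i (w i)]).
  rewrite /distribution /pushforward/=; congr (product_power I p _).
  apply/seteqP; split=> w Aw.
    by move=> _ /mapP[j jr ->]; rewrite A'E//; exact: Aw.
  by move=> j jr; have := Aw _ (map_f s jr); rewrite A'E.
rewrite product_powerE ?map_inj_uniq//.
  by rewrite big_map; apply: eq_big_seq => j /A'E ->.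
move=> i; have [[j jr <-]|nj] := pselect (exists2 j, j \in r & s j = i).
  by rewrite A'E.
rewrite /A' (_ : [set j | _] = set0) ?bigcap_set0//.
by apply/seteqP; split=> // j [ji jr]; apply: nj; exists j.
Qed.

Lemma mixture_exchangeable (I : countType) d (K : measurableType d)
    (R : realType) (mu : probability (seqspace I K) R) :
  mixture_of_product_powers mu -> exchangeable mu.
Proof.
move=> [beta muE] s [sbij _] A mA.
have mTA : measurable (reindex s @^-1` A) by exact: measurable_preimage_reindex.
rewrite /distribution /pushforward/= !muE//; apply: eq_integral => p _.
by apply: product_power_reindex => //; exact: bij_inj.
Qed.

Lemma exchangeable_mixture (I : countType) (e : I -> nat) d
    (K : measurableType d) (R : realType)
    (mu : probability (seqspace I K) R) : bijective e ->
  presentable K R -> exchangeable mu -> mixture_of_product_powers mu.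
Proof.
move=> [g eK gK] presK exmu.
have [|beta nuE] := presK (distribution mu (reindex g)).
  move=> s [[t sK tK] fs] A mA.
  have mgA : measurable (reindex g @^-1` A) by exact: measurable_preimage_reindex.
  (* A permutation [s] of [nat] acts on the transported law as its conjugate [g \o s \o e] acts on
     [mu]; conjugation keeps the support finite. *)
  transitivity (distribution mu (reindex (g \o s \o e)) (reindex g @^-1` A));
    last first.
    apply: exmu => //.
    split.
      by exists (g \o t \o e) => x /=; rewrite gK ?sK ?tK eK.
    rewrite (_ : [set n | _] = e @^-1` [set n | s n <> n]).
      by apply: finite_preimage => // x y _ _ /(can_inj eK).
    apply/seteqP; split=> n /=; first by move=> + sn; apply; rewrite sn eK.
    by move=> + sn; apply; rewrite -[in RHS]sn gK.
  rewrite /distribution /pushforward/=; congr (mu _).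
  by apply/funext => w; congr (A _); apply/funext => i; rewrite /reindex /= gK.
(* The same mixing measure works on [K^I], since product powers are carried to product powers along
   [e]. *)
exists beta => A mA.
have meA : measurable (reindex e @^-1` A) by exact: measurable_preimage_reindex.
transitivity (distribution mu (reindex g) (reindex e @^-1` A)).
  rewrite /distribution /pushforward/=; congr (mu _).
  by apply/funext => w; congr (A _); apply/funext => i; rewrite /reindex /= eK.
rewrite nuE//; apply: eq_integral => p _.
by apply: product_power_reindex => //; exact: can_inj eK.
Qed.

Lemma int_nat_bijection : exists e : int -> nat, bijective e.
Proof.
exists (fun z : int => if z is Posz n then n.*2 else `|z|.*2.-1)%N.
exists (fun n => if odd n then - (Posz n.+1./2) else Posz n./2)%R.
  move=> [n|n]; first by rewrite odd_double doubleK.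
  by rewrite /= odd_double/= doubleK NegzE.
move=> n; have := odd_double_half n; case: ifPn => nodd /= nE; last first.
  by rewrite -[RHS]nE.
by rewrite -[RHS]nE uphalf_half nodd; case: (n./2) => [|k]//=.
Qed.

(** The permuted law agrees with [mu] on measurable sets, so each density has the same integrals as
    the constant 1 and equals it almost everywhere. *)
Lemma exchangeable_quasi_exchangeable_ui I d (K : measurableType d)
    (R : realType) (mu : probability (seqspace I K) R) :
  exchangeable mu -> quasi_exchangeable_ui mu.
Proof.
move=> exmu.
have dom s : finite_permutation s -> distribution mu (reindex s) `<< mu.
  by move=> /exmu muE; apply/null_content_dominatesP => A mA; rewrite muE.
split.
  move=> s hs; split; first exact: dom.
  by apply/null_content_dominatesP => A mA; have <- := exmu s hs A mA.
split=> [_ [s hs <-]|e e0]; first by apply: Radon_Nikodym_integrable; exact: dom.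
(* Threshold 1 serves every permutation and every [e]: the set where [|g|] exceeds 1 is null. *)
exists 1%R => _ [s hs <-].
have dens1 : ae_eq mu setT
    ('d (charge_of_finite_measure (distribution mu (reindex s))) '/d mu) (cst 1).
  apply: integral_ae_eq => //.
    by apply: Radon_Nikodym_integrable; exact: dom.
  move=> A _ mA; rewrite -Radon_Nikodym_integral//; last exact: dom.
  by rewrite integral_cst// mul1e; exact: exmu.
set g := 'd _ '/d _ in dens1 *.
have mg : measurable_fun setT g.
  by apply: (measurable_int mu); apply: Radon_Nikodym_integrable; exact: dom.
have mD : measurable [set x | 1 < `|g x|].
  rewrite -[X in measurable X]setTI.
  by apply: emeasurable_fun_o_infty => //; exact: measurableT_comp.
rewrite (_ : \int[mu]_(x in _) _ = 0) ?lee_fin ?ltW//.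
apply/ae_eq_integral_abs => //; first exact: measurable_funTS.
move: dens1; apply: filterS => w /(_ Logic.I) gw Dw.
by move: Dw; rewrite /= gw /cst gee0_abs ?ltxx.
Qed.

(** The form in which uniform integrability is used: absolute continuity with one [r] for all
    permutations. On [B] the density is at most [|c|] plus its part above the threshold [c]. *)
Lemma permuted_laws_uniformly_continuous I d (K : measurableType d)
    (R : realType) (mu : probability (seqspace I K) R) (e : R) :
  quasi_exchangeable_ui mu -> (0 < e)%R ->
  exists2 r : R, (0 < r)%R & forall s, finite_permutation s ->
    forall B, measurable B -> mu B <= r%:E -> mu (reindex s @^-1` B) <= e%:E.
Proof.
move=> [qe [_ ui]] e0; have [|c uic] := ui (e / 2)%R; first by rewrite divr_gt0.
(* Chosen so that [|c| * r <= e / 2]; the summand 1 keeps the denominator positive. *)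
exists (e / 2 / (`|c| + 1))%R; first by rewrite !divr_gt0// ltr_wpDl.
move=> s hs B mB muB.
have dom := (qe s hs).1.
pose g := 'd (charge_of_finite_measure (distribution mu (reindex s))) '/d mu.
have mg : measurable_fun setT g.
  by apply: (measurable_int mu); exact: Radon_Nikodym_integrable.
have mag : measurable_fun setT (fun x => `|g x|) by exact: measurableT_comp.
pose D := [set x | c%:E < `|g x|].
have mD : measurable D.
  by rewrite -[X in measurable X]setTI; exact: emeasurable_fun_o_infty.
have mh : measurable_fun setT (fun x => `|g x| * (\1_D x)%:E).
  by apply: emeasurable_funM => //; apply/measurable_EFinP; exact: measurable_indic.
have -> : mu (reindex s @^-1` B) = \int[mu]_(x in B) g x.
  by rewrite -Radon_Nikodym_integral.
apply: (@le_trans _ _ (\int[mu]_(x in B) (`|c|%:E + (`|g x| * (\1_D x)%:E)))).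
  apply: le_trans (lee_abs _) _.
  apply: (le_trans (le_abse_integral mu mB (measurable_funTS mg))).
  apply: ge0_le_integral => //.
  - exact: measurable_funTS.
  - by apply: measurable_funTS; exact: emeasurable_funD.
  - move=> x _; rewrite indicE; case: (boolP (x \in D)) => [xD|].
      by rewrite mule1 leeDr// lee_fin.
    rewrite notin_setE/= => /negP; rewrite -leNgt mule0 adde0 => /le_trans; apply.
    by rewrite lee_fin ler_norm.
rewrite ge0_integralD//; last exact: measurable_funTS.
rewrite integral_cst// (splitr e) EFinD; apply: leeD.
  apply: (@le_trans _ _ (`|c|%:E * (e / 2 / (`|c| + 1))%:E)).
    by apply: lee_wpmul2l; rewrite ?lee_fin.
  rewrite -EFinM lee_fin mulrCA ler_piMr//; first by rewrite divr_ge0 ?ltW.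
  by rewrite ler_pdivrMr ?mul1r ?lerDl// ltr_wpDl.
apply: le_trans (uic g _); last by exists s.
rewrite -/D [leRHS]integral_mkcond.
rewrite [leLHS]integral_mkcond; apply: ge0_le_integral => //.
- by move=> x _; rewrite patchE; case: ifP => // _; rewrite mule_ge0 ?lee_fin.
- by apply/(measurable_restrictT _ mB); exact: measurable_funTS.
- by apply/(measurable_restrictT _ mD); exact: measurable_funTS.
- move=> x _; rewrite !patchE indicE; case: (x \in B); case: (x \in D);
    rewrite ?mule1 ?mule0;
    by [exact: lexx | exact: abse_ge0].
Qed.

End mixtures_and_densities.

(** * Integrals of bounded functions and measure-preserving maps *)

Lemma bounded_integrable d (T : measurableType d) (R : realType)
    (mu : probability T R) (f : T -> R) (M : R) :
  measurable_fun setT f -> (forall x, `|f x| <= M) ->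
  mu.-integrable setT (EFin \o f).
Proof.
move=> mf fM; apply: measurable_bounded_integrable => //.
  exact: le_lt_trans (probability_le1 mu measurableT) (ltry 1).
exists M; split; first exact: num_real.
by move=> m Mm x _ /=; rewrite (le_trans (fM x))// ltW.
Qed.

Lemma integrable_sum_EFin d (T : measurableType d) (R : realType)
    (mu : {measure set T -> \bar R}) (n : nat) (f : nat -> T -> R) :
  (forall i, mu.-integrable setT (EFin \o f i)) ->
  mu.-integrable setT (EFin \o (fun x => \sum_(i < n) f i x)).
Proof.
move=> intf; rewrite (_ : _ \o _ = fun x => (\sum_(i < n) (EFin \o f i) x)%E).
  exact: integrable_sum.
by apply/funext => x /=; rewrite sumEFin.
Qed.

Lemma Rintegral_sum d (T : measurableType d) (R : realType)
    (mu : {measure set T -> \bar R}) (n : nat) (f : nat -> T -> R) :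
  (forall i, mu.-integrable setT (EFin \o f i)) ->
  \int[mu]_x (\sum_(i < n) f i x) = \sum_(i < n) \int[mu]_x f i x.
Proof.
move=> intf; elim: n => [|n IHn].
  under eq_Rintegral do rewrite big_ord0.
  by rewrite big_ord0 Rintegral_cst// mul0r.
under eq_Rintegral do rewrite big_ord_recr.
rewrite big_ord_recr/= -IHn RintegralD//.
exact: integrable_sum_EFin.
Qed.

Definition preserves d (T : measurableType d) (R : realType)
    (mu : set T -> \bar R) (S : T -> T) :=
  measurable_fun setT S /\ forall B, measurable B -> mu (S @^-1` B) = mu B.

Lemma preserves_iter d (T : measurableType d) (R : realType)
    (mu : set T -> \bar R) (S : T -> T) (n : nat) :
  preserves mu S -> preserves mu (iter n S).
Proof.
move=> [mS muS]; elim: n => [|n [mSn muSn]].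
  by split=> //; exact: measurable_id.
split; first exact: measurableT_comp mS mSn.
move=> B mB; rewrite -[RHS]muS// -[RHS]muSn//.
by rewrite -[X in measurable X]setTI; exact: mS.
Qed.

Lemma Rintegral_preserves d (T : measurableType d) (R : realType)
    (mu : probability T R) (S : T -> T) (f : T -> R) (M : R) :
  preserves mu S -> measurable_fun setT f -> (forall x, `|f x| <= M) ->
  \int[mu]_x f (S x) = \int[mu]_x f x.
Proof.
move=> [mS muS] mf fM.
pose S' : {mfun T >-> T} := HB.pack S (isMeasurableFun.Build _ _ _ _ S mS).
rewrite /Rintegral; congr fine.
transitivity (\int[distribution mu S']_x (f x)%:E)%E.
  rewrite integral_distribution//; first exact/measurable_EFinP.
  apply: (@bounded_integrable _ _ _ mu (f \o S) M) => [|x]; last exact: fM.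
  exact: measurableT_comp mf mS.
by apply: eq_measure_integral => A mA _; exact: muS.
Qed.

(** * Ergodic averages along doubling times *)

Lemma normr_mean_le1 (R : realFieldType) (n : nat) (a : nat -> R) :
  (forall i, `|a i| <= 1) -> `|(\sum_(i < n) a i) / n%:R| <= 1.
Proof.
move=> a1; have [->|n0] := posnP n; first by rewrite invr0 mulr0 normr0.
rewrite normrM normfV normr_nat ler_pdivrMr ?ltr0n// mul1r.
apply: le_trans (ler_norm_sum _ _ _) _.
apply: (@le_trans _ _ (\sum_(i < n) 1)); first exact: ler_sum.
by rewrite sumr_const card_ord.
Qed.

(* With [a n] the squared L^2 norm of the n-th ergodic average, the parallelogram
   law turns the integral below into [4 * a n - 4 * a (2 * n)]; hence it cannot
   stay above [e] for all [n = 2 ^ k], as [a >= 0]. *)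
Lemma ergodic_averages_close d (T : measurableType d) (R : realType)
    (mu : probability T R) (S : T -> T) (f : T -> R) (e : R) :
  preserves mu S -> measurable_fun setT f -> (forall x, `|f x| <= 1) -> 0 < e ->
  exists2 n, (0 < n)%N &
    \int[mu]_x ((\sum_(i < n) f (iter i S x)) / n%:R -
                (\sum_(i < n) f (iter (n + i) S x)) / n%:R) ^+ 2 <= e.
Proof.
move=> pS mf f1 e0.
pose A n x := (\sum_(i < n) f (iter i S x)) / n%:R.
have A1 n x : `|A n x| <= 1.
  by apply: (@normr_mean_le1 _ n (fun i => f (iter i S x))) => i; exact: f1.
have mfS i : measurable_fun setT (fun x => f (iter i S x)).
  by apply: (measurableT_comp mf); exact: (preserves_iter i pS).1.
have mA n : measurable_fun setT (A n).
  by apply: measurable_funM => //; apply: measurable_sum => i; exact: mfS.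
have mA2 n : measurable_fun setT (fun x => A n x ^+ 2) by exact: measurable_funX.
have A2 n x : `|A n x ^+ 2| <= 1 by rewrite normrX exprn_ile1.
pose a n := \int[mu]_x (A n x ^+ 2).
have iA2 (c : R) n : mu.-integrable setT (EFin \o (fun x => c * A n x ^+ 2)).
  apply: (@bounded_integrable _ _ _ mu _ (`|c|)); first exact: measurable_funM.
  by move=> x; rewrite normrM ler_piMr.
have mAS n m : measurable_fun setT (fun x => A n (iter m S x)).
  by apply: (measurableT_comp (mA n)); exact: (preserves_iter m pS).1.
have iAS (c : R) n m :
    mu.-integrable setT (EFin \o (fun x => c * A n (iter m S x) ^+ 2)).
  apply: (@bounded_integrable _ _ _ mu _ (`|c|)).
    by apply: measurable_funM => //; exact: measurable_funX.
  by move=> x; rewrite normrM ler_piMr.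
have step n : (0 < n)%N -> \int[mu]_x ((\sum_(i < n) f (iter i S x)) / n%:R -
    (\sum_(i < n) f (iter (n + i) S x)) / n%:R) ^+ 2 = 4 * a n - 4 * a n.*2.
  move=> n0.
  transitivity (\int[mu]_x (2 * A n x ^+ 2 + 2 * A n (iter n S x) ^+ 2
                            - 4 * A n.*2 x ^+ 2)).
    apply: eq_Rintegral => x _.
    have shiftE : \sum_(i < n) f (iter (n + i) S x) =
        \sum_(i < n) f (iter i S (iter n S x)).
      by apply: eq_bigr => i _; rewrite addnC iterD.
    (* The midpoint in the parallelogram law: the average over [2 * n] steps is the mean of the
       averages over its two halves. *)
    have -> : A n.*2 x = (A n x + A n (iter n S x)) / 2.
      rewrite /A -addnn big_split_ord/= shiftE natrD.
      by field; rewrite -natrD !pnatr_eq0 addn_eq0 andbb -lt0n n0.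
    rewrite shiftE.
    by rewrite -/(A n x) -/(A n (iter n S x)); field.
  rewrite RintegralB//; last first.
    by apply: (integrableD measurableT (iA2 _ _) (iAS _ _ _)).
  rewrite RintegralD// !RintegralZl//.
  - rewrite (@Rintegral_preserves _ _ _ mu _ (fun x => A n x ^+ 2) 1
      (preserves_iter n pS))//.
    by rewrite -/(a _) -/(a _); ring.
  - by have := iA2 1 n.*2; under eq_fun do rewrite mul1r.
  - by have := iAS 1 n n; under eq_fun do rewrite mul1r.
  - by have := iA2 1 n; under eq_fun do rewrite mul1r.
apply: contrapT => none.
have big n : (0 < n)%N -> e < 4 * a n - 4 * a n.*2.
  by move=> n0; rewrite -step// ltNge; apply/negP => small; apply: none; exists n.
have drop k : 4 * a (2 ^ k)%N <= 4 * a 1%N - e *+ k.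
  elim: k => [|k IHk]; first by rewrite subr0.
  have := big (2 ^ k)%N; rewrite expn_gt0 => /(_ erefl); rewrite -mul2n -expnS.
  by rewrite mulrS; lra.
have a0 n : 0 <= a n by apply: Rintegral_ge0 => x _; exact: sqr_ge0.
(* Enough doublings for the total drop [e *+ k] to exceed [4 * a 1], which would make [a (2 ^ k)]
   negative. *)
pose k := (Num.truncn (4 * a 1%N / e)).+1.
have : 4 * a 1%N < e *+ k.
  by rewrite -[e *+ k]mulr_natl -ltr_pdivrMr//; exact: truncnS_gt.
by have := drop k; have := a0 (2 ^ k)%N; lra.
Qed.

(** * From smallness in L^2 to smallness in measure, and from there to smallness in mean *)

(** Chebyshev's inequality: integrate the pointwise bound [\1_B * e ^+ 2 <= h ^+ 2], where [B] is
    the set in question. The bound [M] provides integrability. *)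
Lemma chebyshev_Rintegral d (T : measurableType d) (R : realType)
    (mu : probability T R) (h : T -> R) (M e r : R) :
  measurable_fun setT h -> (forall x, `|h x| <= M) -> 0 < e ->
  \int[mu]_x (h x ^+ 2) <= r * e ^+ 2 ->
  (mu [set x | (e <= `|h x|)%R] <= r%:E)%E.
Proof.
move=> mh hM e0 hr.
pose B := [set x | e <= `|h x|].
have mB : measurable B.
  rewrite -[B]setTI; apply: measurable_fun_le => //.
  exact: measurableT_comp.
have ih2 : mu.-integrable setT (EFin \o (fun x => h x ^+ 2)).
  apply: (@bounded_integrable _ _ _ mu _ (M ^+ 2)); first exact: measurable_funX.
  by move=> x; rewrite normrX ler_pXn2r// nnegrE (le_trans _ (hM x)).
have iB : mu.-integrable setT (EFin \o \1_B) by exact: integrable_indic.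
rewrite -/B -(@fineK _ (mu B)) ?fin_num_measure// lee_fin.
rewrite -(@ler_pM2r _ (e ^+ 2)) ?exprn_gt0// (le_trans _ hr)//.
have -> : fine (mu B) = \int[mu]_x \1_B x.
  by rewrite /Rintegral integral_indic// setIT.
rewrite -RintegralZr//; apply: le_Rintegral => //.
  apply: (@bounded_integrable _ _ _ mu _ (e ^+ 2)); first exact: measurable_funM.
  move=> x; rewrite normrM [`|e ^+ 2|]ger0_norm ?sqr_ge0//.
  by rewrite ler_piMl ?sqr_ge0// indicE; case: (_ \in _); rewrite ?normr1 ?normr0.
move=> x _; rewrite indicE; case: (boolP (x \in B)) => [|_];
  last by rewrite mul0r sqr_ge0.
rewrite inE/= mul1r => ex; rewrite -[leRHS]real_normK ?num_real//.
by rewrite ler_pXn2r// nnegrE// ltW.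
Qed.

(** Pointwise [|h| <= e + M * \1_B], where [B] is the set on which [|h|] is at least [e]. *)
Lemma normr_Rintegral_le d (T : measurableType d) (R : realType)
    (mu : probability T R) (h : T -> R) (M e : R) :
  measurable_fun setT h -> (forall x, `|h x| <= M) -> 0 < e ->
  (mu [set x | (e <= `|h x|)%R] <= e%:E)%E ->
  `|\int[mu]_x h x| <= e + M * e.
Proof.
move=> mh hM e0 he.
pose B := [set x | e <= `|h x|].
have mB : measurable B.
  rewrite -[B]setTI; apply: measurable_fun_le => //.
  exact: measurableT_comp.
have M0 : 0 <= M by apply: le_trans (hM point).
have iB : mu.-integrable setT (EFin \o \1_B) by exact: integrable_indic.
have ih : mu.-integrable setT (EFin \o h) by exact: bounded_integrable hM.
have iMB : mu.-integrable setT (EFin \o (fun x => M * \1_B x)).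
  apply: (@bounded_integrable _ _ _ mu _ (M)); first exact: measurable_funM.
  move=> x; rewrite normrM (ger0_norm M0) ler_piMr//.
  by rewrite indicE; case: (_ \in _); rewrite ?normr1 ?normr0.
have ie : mu.-integrable setT (EFin \o (fun _ : T => e)).
  by apply: (@bounded_integrable _ _ _ mu _ (`|e|)).
apply: le_trans (le_normr_Rintegral _ ih) _ => //.
apply: (@le_trans _ _ (\int[mu]_x (e + M * \1_B x))).
  apply: le_Rintegral => //.
  - apply: (@bounded_integrable _ _ _ mu _ (M)); first exact: measurableT_comp.
    by move=> x; rewrite normr_id.
  - exact: (integrableD measurableT ie iMB).
  - move=> x _; rewrite indicE; case: (boolP (x \in B)) => [_|].
      by rewrite mulr1 (le_trans (hM x))// lerDr ltW.
    by rewrite notin_setE/= => /negP; rewrite -ltNge mulr0 addr0 => /ltW.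
have inte : \int[mu]_(_ in setT) e = e.
  by rewrite Rintegral_cst// [X in fine X](probability_setT mu) mulr1.
rewrite RintegralD// inte RintegralZl//.
rewrite lerD2l ler_wpM2l// /Rintegral integral_indic// setIT.
by rewrite -lee_fin fineK ?fin_num_measure.
Qed.

(** * Copies of a finite permutation on consecutive blocks of integers *)

Local Notation block_length N := (Posz N.*2.+1).

(** Block [q] is centred at [q * block_length N] and has radius [N], hence the shift by [N] before
    the division. On the blocks [0 <= q < n] the map acts as a translate of [s]. *)
Definition copy_on_blocks (N n : nat) (s : int -> int) (z : int) : int :=
  let q := ((z + N%:Z) %/ block_length N)%Z in
  if 0 <= q < n%:Z then s (z - q * block_length N) + q * block_length N else z.

Lemma copy_on_blocksE N n s (i q : int) : `|i| <= N%:Z ->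
  copy_on_blocks N n s (i + q * block_length N) =
  (if 0 <= q < n%:Z then s i else i) + q * block_length N.
Proof.
move=> iN; rewrite /copy_on_blocks.
have -> : ((i + q * block_length N + N%:Z) %/ block_length N)%Z = q.
  rewrite (_ : i + q * block_length N + N%:Z = q * block_length N + (i + N%:Z));
    last by ring.
  rewrite divzMDl// divz_small ?addr0//.
  by move: iN; rewrite ler_norml; lia.
by case: ifP; rewrite ?addrK.
Qed.

Lemma block_decomposition (N : nat) (z : int) :
  exists i q : int, `|i| <= N%:Z /\ z = i + q * block_length N.
Proof.
exists (((z + N%:Z) %% block_length N)%Z - N%:Z), ((z + N%:Z) %/ block_length N)%Z.
have := divz_eq (z + N%:Z) (block_length N).
have := modz_ge0 (z + N%:Z) (d := block_length N) isT.
have := ltz_pmod (z + N%:Z) (d := block_length N) isT.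
set q := (_ %/ _)%Z; set r := (_ %% _)%Z; move=> rL r0 zE.
split; last by rewrite addrAC; lia.
by rewrite ler_norml; lia.
Qed.

(** As [s] preserves the central block, its translates do not interfere, and copying the inverse of
    [s] inverts the copy. *)
Lemma finite_permutation_copy_on_blocks N n (s : int -> int) : bijective s ->
  (forall z : int, s z <> z -> `|z| <= N%:Z) ->
  finite_permutation (copy_on_blocks N n s).
Proof.
move=> [t sK tK] sN.
(* By injectivity the image of a moved point is itself moved, so it stays within the central
   block. *)
have inN (u v : int -> int) : cancel u v ->
    (forall z, u z <> z -> `|z| <= N%:Z) ->
    forall z, `|z| <= N%:Z -> `|u z| <= N%:Z.
  move=> uK uN z zN; have [->//|uz] := pselect (u z = z).
  by apply: uN => /(can_inj uK).
have tN z : t z <> z -> `|z| <= N%:Z.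
  by move=> tz; apply: sN => sz; apply: tz; rewrite -{1}sz sK.
have canc (u v : int -> int) : cancel u v ->
    (forall z, u z <> z -> `|z| <= N%:Z) ->
    cancel (copy_on_blocks N n u) (copy_on_blocks N n v).
  move=> uK uN z; have [i [q [iN ->]]] := block_decomposition N z.
  rewrite copy_on_blocksE// copy_on_blocksE;
    last by case: ifP => // _; exact: inN uK _ _ _.
  by case: (_ && _); rewrite ?uK.
split; first by exists (copy_on_blocks N n t); exact: canc.
(* Moved points lie in blocks 0 to [n - 1], hence among the [m] consecutive integers from [- N] on;
   [m] allows for [n + 1] blocks. *)
have [m mE] : exists m, m = (n.+1 * N.*2.+1)%N by eexists.
apply: (@sub_finite_set _ _ [set` [seq i%:Z - N%:Z | i <- iota 0 m]]).
  move=> z /= sz; have [i [q [iN zE]]] := block_decomposition N z.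
  move: sz; rewrite zE copy_on_blocksE//; case: ifP => // /andP[q0 qn] _.
  apply/mapP; exists (absz (i + q * block_length N + N%:Z)).
    rewrite mem_iota /= add0n; move: iN; rewrite ler_norml; nia.
  move: iN; rewrite ler_norml; nia.
by apply/finite_seqP; eexists.
Qed.

(** * Shifts by a whole block, and exchangeability from uniform integrability *)

Lemma stationary_shift d (K : measurableType d) (R : realType)
    (mu : probability (seqspace int K) R) (k : nat) :
  stationary mu -> preserves mu
    (reindex (fun j => j + k%:Z) : seqspace int K -> seqspace int K).
Proof.
move=> st; split=> [|B mB]; first exact: measurable_reindex.
elim: k => [|k IHk].
  congr (mu _); apply/funext => w; congr (B _); apply/funext => j.
  by rewrite /reindex addr0.
rewrite -[RHS]IHk -[RHS]st; last exact: measurable_preimage_reindex.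
rewrite /distribution /pushforward/=.
congr (mu _); apply/funext => w; congr (B _); apply/funext => j.
by rewrite /reindex; congr (w _); lia.
Qed.

Lemma iter_shift (K : Type) (L : int) (n : nat) (w : int -> K) :
  iter n (fun v : int -> K => v \o (fun j => j + L)) w =
  w \o (fun j => j + n%:Z * L).
Proof.
elim: n => [|n IHn]; first by apply/funext => j /=; rewrite mul0r addr0.
by rewrite iterS IHn; apply/funext => j /=; congr (w _); lia.
Qed.

Lemma quasi_exchangeable_ui_exchangeable d (K : measurableType d)
    (R : realType) (mu : probability (seqspace int K) R) :
  quasi_exchangeable_ui mu -> stationary mu -> exchangeable mu.
Proof.
move=> qe st s [sbij /finite_seqP[supp suppE]] B mB.
(* It suffices to treat a cylinder [C], which depends only on the coordinates in the finite list
   [r]. *)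
apply: seqspace_probability_unique mB => r A _ mA.
set C := [set w | _].
have mC : measurable (C : set (seqspace int K)) by exact: measurable_cylinder.
have msC : measurable (reindex s @^-1` C) by exact: measurable_preimage_reindex.
rewrite [LHS](_ : _ = mu (reindex s @^-1` C))//.
rewrite -[LHS]fineK ?fin_num_measure// -[RHS]fineK ?fin_num_measure//.
congr EFin; apply/eqP; rewrite -subr_eq0 -normr_le0.
apply/ler_addgt0Pr => e' e'0; rewrite add0r.
(* The final bound is [e + 2 * e], the factor 2 being the bound on the difference [h] of two
   averages. *)
pose e := e' / 3.
have e0 : 0 < e by rewrite divr_gt0.
have [rho rho0 uc] := permuted_laws_uniformly_continuous qe e0.
(* The central block must contain both the coordinates seen by [C] and the points moved by [s]. *)
pose N := (\max_(z <- r ++ supp) absz z)%N.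
have rN z : z \in r -> `|z| <= N%:Z.
  move=> zr; rewrite -[`|z|]/(Posz (absz z)) lez_nat.
  by apply: (@leq_bigmax_seq _ _ xpredT absz z) => //; rewrite mem_cat zr.
have sN (z : int) : s z <> z -> `|z| <= N%:Z.
  move=> sz; rewrite -[`|z|]/(Posz (absz z)) lez_nat.
  apply: (@leq_bigmax_seq _ _ xpredT absz z) => //; rewrite mem_cat.
  by move: sz; rewrite -[s z <> z]/([set n | s n <> n] z) suppE => /= ->;
    rewrite orbT.
pose S : seqspace int K -> seqspace int K :=
  reindex (fun j => j + (N.*2.+1)%:Z).
have pS : preserves mu S by exact: stationary_shift.
pose f : seqspace int K -> R := \1_C.
have mf : measurable_fun setT f by exact: measurable_indic.
have f1 x : `|f x| <= 1.
  by rewrite /f indicE; case: (_ \in _); rewrite ?normr1 ?normr0.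
(* With tolerance [rho * e ^+ 2], Chebyshev leaves mass at most [rho] where [|h|] is at least [e];
   this is what [uc] requires, whatever [n] turns out to be. *)
have [|n n0] := @ergodic_averages_close _ _ _ mu S f (rho * e ^+ 2) pS mf f1.
  by rewrite mulr_gt0// exprn_gt0.
set h := fun x => (\sum_(i < n) f (iter i S x)) / n%:R -
  (\sum_(i < n) f (iter (n + i) S x)) / n%:R.
rewrite -/(\int[mu]_x (h x ^+ 2)) => hsmall.
have mfS i : measurable_fun setT (fun x => f (iter i S x)).
  by apply: (measurableT_comp mf); exact: (preserves_iter i pS).1.
have mh : measurable_fun setT h.
  by apply: measurable_funB; apply: measurable_funM => //;
    apply: measurable_sum => i.
have h2 x : `|h x| <= 2.
  rewrite (le_trans (ler_normB _ _))// (_ : 2 = 1 + 1)// lerD//.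
    by apply: (@normr_mean_le1 _ n (fun i => f (iter i S x))).
  by apply: (@normr_mean_le1 _ n (fun i => f (iter (n + i) S x))).
have Bsmall := chebyshev_Rintegral mh h2 e0 hsmall.
pose sn := copy_on_blocks N n s.
have fsn : finite_permutation sn by exact: finite_permutation_copy_on_blocks.
pose T : seqspace int K -> seqspace int K := reindex sn.
have mT : measurable_fun setT T by exact: measurable_reindex.
have mhT : measurable_fun setT (h \o T) by exact: measurableT_comp mh mT.
have := @normr_Rintegral_le _ _ _ mu (h \o T) 2 e mhT (fun x => h2 (T x)) e0.
have mD : measurable [set x | e <= `|h x|].
  rewrite -[X in measurable X]setTI; apply: measurable_fun_le => //.
  exact: measurableT_comp.
(* The set where [|h \o T|] is at least [e] is the preimage under [T] of the one for [h]. The choice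
   of [rho] precedes that of [n], and so of [sn], so uniformity over permutations is essential. *)
move=> /(_ (uc sn fsn _ mD Bsmall)).
rewrite (_ : e + 2 * e = e'); last by rewrite /e; field.
suff -> : \int[mu]_x (h \o T) x = fine (mu (reindex s @^-1` C)) - fine (mu C) by [].
pose fs : seqspace int K -> R := \1_(reindex s @^-1` C).
have mfs : measurable_fun setT fs by exact: measurable_indic.
have fs1 x : `|fs x| <= 1.
  by rewrite /fs indicE; case: (_ \in _); rewrite ?normr1 ?normr0.
(* The term [f (iter i S x)] reads block [i] only. In the first average [i < n], so [T] turns [C]
   into its preimage under [reindex s]; the second average reads blocks from [n] on, which [T]
   fixes. *)
have hT x : (h \o T) x = n%:R^-1 * (\sum_(i < n) fs (iter i S x)) -
    n%:R^-1 * (\sum_(i < n) f (iter (n + i) S x)).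
  have SE m (w : seqspace int K) :
      iter m S w = fun j => w (j + m%:Z * (N.*2.+1)%:Z).
    exact: iter_shift.
  have CE (w w' : seqspace int K) : (forall z, z \in r -> w z = w' z) -> C w = C w'.
    move=> ww'; apply/propext; split=> Cw z zr;
      by have := Cw z zr; rewrite ww'.
  have indicP (U V : set (seqspace int K)) u v : U u = V v -> \1_U u = \1_V v :> R.
    move=> UV; rewrite !indicE; congr (_ : bool)%:R.
    by apply/idP/idP; rewrite !inE UV.
  rewrite /h /= ![_^-1 * _]mulrC; congr (_ / _ - _ / _).
    apply: eq_bigr => i _; apply: indicP; rewrite /preimage/=; apply: CE => z zr.
    rewrite SE /reindex SE /T /reindex /sn copy_on_blocksE ?rN//.
    by rewrite ltz_nat ltn_ord.
  apply: eq_bigr => i _; apply: indicP; apply: CE => z zr.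
  rewrite !SE /T /reindex /sn copy_on_blocksE ?rN//.
  by rewrite ltz_nat ltnNge leq_addr andbF.
under eq_Rintegral do rewrite hT.
have int_fS i : mu.-integrable setT (EFin \o (fun x => f (iter i S x))).
  by apply: (@bounded_integrable _ _ _ mu _ 1) => // x; exact: f1.
have mfsS i : measurable_fun setT (fun x => fs (iter i S x)).
  by apply: (measurableT_comp mfs); exact: (preserves_iter i pS).1.
have int_fsS i : mu.-integrable setT (EFin \o (fun x => fs (iter i S x))).
  by apply: (@bounded_integrable _ _ _ mu _ 1) => // x; exact: fs1.
have ifs := @integrable_sum_EFin _ _ _ mu n _ int_fsS.
have if_ := @integrable_sum_EFin _ _ _ mu n _ (fun i => int_fS (n + i)%N).
have scal g : mu.-integrable setT (EFin \o g) ->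
    mu.-integrable setT (EFin \o (fun x => n%:R^-1 * g x)).
  exact: integrableZl.
rewrite RintegralB//; [|exact: scal|exact: scal].
rewrite !RintegralZl//.
rewrite (@Rintegral_sum _ _ _ mu n (fun i x => fs (iter i S x)))//.
rewrite (@Rintegral_sum _ _ _ mu n (fun i x => f (iter (n + i) S x)))//.
have n0' : n%:R != 0 :> R by rewrite pnatr_eq0 -lt0n.
have avg (c : R) : n%:R^-1 * \sum_(i < n) c = c.
  by rewrite sumr_const card_ord -[c *+ n]mulr_natl mulKf.
(* By invariance under the shift all terms of an average have the same expectation, which is then
   that of the whole average. *)
congr (_ - _).
  rewrite -[RHS]avg; congr (_ * _); apply: eq_bigr => i _.
  rewrite (@Rintegral_preserves _ _ _ mu _ fs 1 (preserves_iter i pS))//.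
  by rewrite /Rintegral integral_indic// setIT.
rewrite -[RHS]avg; congr (_ * _); apply: eq_bigr => i _.
rewrite (@Rintegral_preserves _ _ _ mu _ f 1 (preserves_iter (n + i) pS))//.
by rewrite /Rintegral integral_indic// setIT.
Qed.

(** * The cycle of implications between the three properties *)

Theorem theorem2 (d d' : measure_display) (K : measurableType d) (R : realType)
    (Om : measurableType d') (P : probability Om R)
    (X : int -> {RV P >-> K}) :
  presentable K R -> stationary (law X) ->
  [<-> exchangeable (law X);
       quasi_exchangeable_ui (law X);
       mixture_of_product_powers (law X)].
Proof.
move=> presK st; tfae.
- exact: exchangeable_quasi_exchangeable_ui.
(* Property (3) is reached from (2) through exchangeability, the only place where stationarity
   enters. *)
- move=> qe; have [e be] := int_nat_bijection.
  exact: exchangeable_mixture be presK (quasi_exchangeable_ui_exchangeable qe st).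
- exact: mixture_exchangeable.
Qed.
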